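(* Let $n$ be a positive integer. (1) There is a connected graph $\Delta$ such that $\mathsf{wCop}(\Delta)=n$ and $\mathsf{sCop}(\Delta)=n$. (2) There is a connected graph $\Gamma$ such that $\mathsf{wCop}(\Gamma)=\infty$ and $\mathsf{sCop}(\Gamma)=n$.
   Context: Graphs are undirected, without double edges and without loops. Cop numbers are defined for connected graphs. For a connected graph $\Gamma$, $\mathsf{dist}$ is the path distance on $V(\Gamma)$. Game. The cops and robber game on a connected graph $\Gamma$ has parameters: number of cops $n$, cop speed $\sigma$, cop reach $\rho$, robber speed $\psi$, a vertex $v$, and a positive integer $R$. It is a perfect information game. First the $n$ cops choose initial vertices $c^1_0,\dots,c^n_0$; then, knowing these, the robber chooses an initial vertex $r_0$. In stage $k\ge 1$ each cop moves from $c^i_{k-1}$ to a vertex $c^i_k$ with $\mathsf{dist}(c^i_{k-1},c^i_k)\le\sigma$. The robber is captured during stage $k$ if $\mathsf{dist}(r_{k-1},c^i_k)\le\rho$ for some $i$. If not captured, the robber moves from $r_{k-1}$ to a vertex $r_k$ such that there is a path from $r_{k-1}$ to $r_k$ of length at most $\psi$ all of whose vertices are at distance larger than $\rho$ from every $c^i_k$. The cops win (protect the $R$-ball centered at $v$) if the robber is captured at some stage or there is $N>0$ such that $\mathsf{dist}(v,r_k)>R$ for all $k\ge N$. $\Gamma$ is $\mathsf{CopWin}(n,\sigma,\rho,\psi,R)$ if for every vertex $v$ of $\Gamma$ the $n$ cops have a winning strategy in the game with parameters $n,\sigma,\rho,\psi,v,R$. $\Gamma$ is $n$-weak cop win if $\exists\,\sigma\in\mathbb{Z}_{>0}\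 \exists\,\rho\in\mathbb{Z}_{\ge0}\ \forall\,\psi,R\in\mathbb{Z}_{>0}$: $\Gamma$ is $\mathsf{CopWin}(n,\sigma,\rho,\psi,R)$. $\Gamma$ is $n$-strong cop win if $\exists\,\sigma\in\mathbb{Z}_{>0}\ \forall\,\psi\in\mathbb{Z}_{>0}\ \exists\,\rho\in\mathbb{Z}_{\ge0}\ \forall\,R\in\mathbb{Z}_{>0}$: $\Gamma$ is $\mathsf{CopWin}(n,\sigma,\rho,\psi,R)$. The weak cop number $\mathsf{wCop}(\Gamma)$ (resp. strong cop number $\mathsf{sCop}(\Gamma)$) in $\mathbb{Z}_{>0}\cup\{\infty\}$ is the smallest positive integer $n$ such that $\Gamma$ is $n$-weak (resp. $n$-strong) cop win, and $\infty$ if there is none. *)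

(* Defs.v *)
(* MathComp, with classical logic from mathcomp.classical.boolp. *)
From mathcomp Require Import all_boot.
From mathcomp Require Import boolp.

Set Implicit Arguments.
Unset Strict Implicit.
Unset Printing Implicit Defensive.

(* Vertex sets may be infinite. *)
Record graph := Graph {
  vertex :> Type;
  adj : rel vertex;
  adj_sym : symmetric adj;
  adj_irr : irreflexive adj }.

(* [x :: p] is the list of vertices of a path of length [size p] from x to y;
   vertices may be repeated, which affects neither distances nor the existence
   of a path of length at most psi inside a given set of vertices. *)
Definition path_from_to (G : graph) (x y : G) (p : seq G) : Prop :=
  path (@adj G) x p /\ last x p = y.

Definition connected (G : graph) : Prop :=
  inhabited G /\ forall x y : G, exists p, path_from_to x y p.

Record connected_graph := ConnectedGraph {
  underlying :> graph;
  connectedP : connected underlying }.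

Section Distance.
Variable G : connected_graph.

Definition path_length (x y : G) (k : nat) : Prop :=
  exists p, path_from_to x y p /\ size p = k.

Lemma path_length_ex (x y : G) : exists k, `[< path_length x y k >].
Proof.
have [p xpy] := (connectedP G).2 x y.
by exists (size p); apply/asboolP; exists p.
Qed.

Definition dist (x y : G) : nat := ex_minn (path_length_ex x y).

End Distance.

Section Game.
Variables (G : connected_graph) (n : nat).

Definition cops := 'I_n -> G.

(* The history seen by the cops before stage k is
   [:: (c_0, r_0); ...; (c_(k-1), r_(k-1))]. *)
Record strategy := Strategy {
  start : cops;
  move : seq (cops * G) -> cops }.

(* Legality is required on all nonempty histories, even those which the strategy
   never produces; this costs nothing, since staying put is always legal. *)
Definition legal_strategy (sigma : nat) (S : strategy) : Prop :=
  forall (h : seq (cops * G)) (c : cops) (r : G) (i : 'I_n),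
    dist (c i) (move S (rcons h (c, r)) i) <= sigma.

Definition follows (S : strategy) (c : nat -> cops) (r : nat -> G) : Prop :=
  c 0 = start S /\
  forall k, c k.+1 = move S (mkseq (fun j => (c j, r j)) k.+1).

(* Capture during stage k.+1, when the robber still stands at r_k. *)
Definition captured (rho : nat) (c : nat -> cops) (r : nat -> G) (k : nat) :
    Prop :=
  exists i : 'I_n, dist (r k) (c k.+1 i) <= rho.

Definition robber_move (rho psi : nat) (c : cops) (x y : G) : Prop :=
  exists p, [/\ path_from_to x y p, size p <= psi &
    forall j, j <= size p -> forall i : 'I_n, rho < dist (nth x (x :: p) j) (c i)].

(* A play stopped by a capture is represented by any infinite continuation: the
   robber's moves are constrained only as long as he has not been captured. *)
Definition robber_plays (rho psi : nat) (c : nat -> cops) (r : nat -> G) :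
    Prop :=
  forall k, (forall j, j <= k -> ~ captured rho c r j) ->
    robber_move rho psi (c k.+1) (r k) (r k.+1).

Definition cops_win (rho : nat) (v : G) (R : nat) (c : nat -> cops)
    (r : nat -> G) : Prop :=
  (exists k, captured rho c r k) \/
  (exists2 N, 0 < N & forall k, N <= k -> R < dist v (r k)).

Definition CopWin (sigma rho psi R : nat) : Prop :=
  forall v : G, exists S : strategy, legal_strategy sigma S /\
    forall (c : nat -> cops) (r : nat -> G),
      follows S c r -> robber_plays rho psi c r -> cops_win rho v R c r.

Definition weak_cop_win : Prop :=
  exists2 sigma, 0 < sigma & exists rho,
  forall psi R, 0 < psi -> 0 < R -> CopWin sigma rho psi R.

Definition strong_cop_win : Prop :=
  exists2 sigma, 0 < sigma & forall psi, 0 < psi ->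
  exists rho, forall R, 0 < R -> CopWin sigma rho psi R.

End Game.

(* The least positive n satisfying P; None stands for infinity. *)
Definition least_positive (P : nat -> Prop) : option nat :=
  if pselect (exists n, `[< 0 < n /\ P n >]) is left exP
  then Some (ex_minn exP) else None.

Definition wCop (G : connected_graph) : option nat :=
  least_positive (weak_cop_win G).

Definition sCop (G : connected_graph) : option nat :=
  least_positive (strong_cop_win G).

(* Main.v *)
Require Import Defs.
From mathcomp Require Import all_boot.
From mathcomp Require Import zify.
From mathcomp Require Import boolp.

Set Implicit Arguments.
Unset Strict Implicit.
Unset Printing Implicit Defensive.

(** One cop wins on a finite graph, since the reach rho may exceed its diameter.
So the lower bounds need one graph that shows the same obstruction at every
scale, while the upper bounds need the cops to cope with all the scales at once.

In the graph Delta a root is joined to one piece for every scale m. The piece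
of scale m has n hubs and infinitely many stars; each star has one spoke of
length about m to each hub, and the inner ends of its n spokes form a clique.
With infinitely many stars, a robber who runs from one hub to another can always
choose a star that no cop has entered.

Fewer than n cops lose ([bouquet_not_strong]): the robber plays at a scale m far
larger than rho and waits on a hub. When a cop approaches, that cop guards only
the robber's hub, so some other hub has no cop on its side; the robber runs
there through an empty star. Four times faster than the cops, he stays out of
reach of the cop behind him, and he arrives before any other cop is near.

n cops win whatever the speed of the robber ([bouquet_CopWin]): one cop holds
the root, which locks the robber into a piece, while the others walk to its
hubs. Once all hubs are held the robber is locked into one star, and the n cops
walk down its spokes together. Reach 0 and speed 1 suffice, whence
wCop = sCop = n.

For Gamma one more piece X is hung at the root. One cop starting from the
root should control X when rho may depend on psi, but no number of cops should
control it when rho is fixed first; being a retract of Gamma, X then gives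
wCop = infinity ([evasion_retract]). X is a graph of hyperbolic type, the
cone: level k is the set of all sequences of natural numbers, joined when they
differ by at most one in each coordinate, and halving all the coordinates leads
to the level above.

- Moving up a level halves horizontal distances, so if a robber of
  speed psi is 2 * psi levels below a cop who stands on his ancestor, then one
  move changes that ancestor by at most one, and the cop can step to
  the robber's new ancestor one level further down. The robber is driven to
  infinity ([cone_one_cop_herds]).

- With rho fixed, a robber of huge speed crosses, in a single move, a distance
  that is far greater than the reach at a deep level, changing a single
  coordinate. On coordinates halved up to a common level, the vertices near a
  cop form a product of intervals, so it meets two routes along different
  coordinates only if it contains their common origin. Each cop can therefore
  block one route at most, he can threaten one at most of their destinations,
  which are far from each other, and there are infinitely many routes
  ([cone_evasion]). *)

(** * Walks and distances *)

Section Walks.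
Variable G : graph.

Definition reach (x y : G) : Prop := exists p, path_from_to x y p.

Lemma reach_adj (x y : G) : adj x y -> reach x y.
Proof. by move=> xy; exists [:: y]; split; rewrite //= xy. Qed.

Lemma reach_refl (x : G) : reach x x.
Proof. by exists [::]. Qed.

Lemma path_from_to_cat (x y z : G) p q :
  path_from_to x y p -> path_from_to y z q -> path_from_to x z (p ++ q).
Proof.
by move=> [xp px] [yq qy]; split; rewrite ?cat_path ?last_cat px // xp.
Qed.

Lemma path_from_to_rev (x y : G) p :
  path_from_to x y p -> path_from_to y x (rev (belast x p)).
Proof.
move=> [xp <-]; split; last by case: p xp => //= z p _; rewrite rev_cons last_rcons.
by rewrite rev_path (@eq_path _ _ (@adj G)) // => u v; rewrite adj_sym.
Qed.

Lemma reach_trans (x y z : G) : reach x y -> reach y z -> reach x z.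
Proof. by move=> [p xp] [q yq]; exists (p ++ q); apply: path_from_to_cat yq. Qed.

Lemma reach_sym (x y : G) : reach x y -> reach y x.
Proof. by move=> [p /path_from_to_rev xp]; eexists; exact: xp. Qed.

Lemma connected_from (r : G) : (forall x, reach x r) -> connected G.
Proof.
move=> toroot; split; first by exists.
by move=> x y; apply: reach_trans (reach_sym (toroot y)).
Qed.

(** A walk cannot leave a set whose outer boundary it avoids. *)
Lemma walk_stays (A ok : G -> Prop) (x y : G) p :
  A x -> (forall u v, A u -> ok u -> adj u v -> ok v -> A v) ->
  path_from_to x y p ->
  (forall j, j <= size p -> ok (nth x (x :: p) j)) -> A y.
Proof.
move=> Ax closed [xp <-]; elim: p x xp Ax => //= z p IHp x /andP[xz zp] Ax okp.
have Az : A z by apply: (closed x) => //; [exact: (okp 0) | exact: (okp 1)].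
apply: IHp => // j jp; rewrite (set_nth_default x) //; exact: (okp j.+1).
Qed.

End Walks.

Section DistanceTheory.
Variable G : connected_graph.
Implicit Types x y z : G.

Lemma dist_walk x y : exists p, path_from_to x y p /\ size p = dist x y.
Proof. by rewrite /dist; case: ex_minnP => k /asboolP. Qed.

Lemma dist_le_walk x y p : path_from_to x y p -> dist x y <= size p.
Proof.
move=> xp; rewrite /dist; case: ex_minnP => k _; apply.
by apply/asboolP; exists p.
Qed.

Lemma dist_refl x : dist x x = 0.
Proof. by apply/eqP; rewrite -leqn0; apply: (@dist_le_walk x x [::]). Qed.

Lemma dist_adj x y : adj x y -> dist x y <= 1.
Proof. by move=> xy; apply: (@dist_le_walk x y [:: y]); split; rewrite //= xy. Qed.

Lemma dist_sym x y : dist x y = dist y x.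
Proof.
wlog suff: x y / dist x y <= dist y x.
  by move=> le; apply/eqP; rewrite eqn_leq !le.
have [p [/path_from_to_rev xp <-]] := dist_walk y x.
by have := dist_le_walk xp; rewrite size_rev size_belast.
Qed.

Lemma dist_triangle y x z : dist x z <= dist x y + dist y z.
Proof.
have [p [xp <-]] := dist_walk x y; have [q [yq <-]] := dist_walk y z.
by rewrite -size_cat; apply/dist_le_walk/path_from_to_cat/yq.
Qed.

Lemma lipschitz_dist (f : G -> nat) x y :
  (forall u v, adj u v -> f v <= (f u).+1) -> f y <= f x + dist x y.
Proof.
move=> lip; have [p [[xp <-] <-]] := dist_walk x y.
elim: p x xp => /= [|z p IHp] x; first by rewrite addn0.
by move=> /andP[/lip xz /IHp]; lia.
Qed.

End DistanceTheory.

(** Edges may be collapsed: this covers both embeddings and retractions. *)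
Lemma contraction_dist (G H : connected_graph) (f : G -> H) (x y : G) :
  (forall u v, adj u v -> f u = f v \/ adj (f u) (f v)) ->
  dist (f x) (f y) <= dist x y.
Proof.
move=> contr; have [p [[xp <-] <-]] := dist_walk x y.
elim: p x xp => /= [|z p IHp] x; first by rewrite dist_refl.
move=> /andP[/contr xz /IHp zp]; apply: leq_trans (dist_triangle (f z) _ _) _.
case: xz => [->|/dist_adj]; rewrite ?dist_refl; lia.
Qed.

(** Lower bounds on the distance from [x] inside a region [S] follow from lower
bounds outside it and from the Lipschitz property on the edges that end in [S]
alone; [g] need not be Lipschitz elsewhere. *)
Lemma barrier_dist (G : connected_graph) (S : G -> Prop) (g : G -> nat) (x y : G) :
  ~ S x -> (forall u, ~ S u -> g u <= dist x u) ->
  (forall u v, adj u v -> S v -> g v <= (g u).+1) -> g y <= dist x y.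
Proof.
move=> Sx gout gin; have [p [[xp <-] <-]] := dist_walk x y.
elim/last_ind: p xp => [_|p w IHp].
  by apply: leq_trans (gout x Sx) _; rewrite dist_refl.
rewrite rcons_path last_rcons size_rcons => /andP[xp pw].
have [Sw|Sw] := pselect (S w).
  by apply: leq_trans (gin _ _ pw Sw) _; rewrite ltnS IHp.
apply: leq_trans (gout w Sw) _; rewrite -(size_rcons p w).
by apply: dist_le_walk; split; rewrite ?last_rcons // rcons_path xp.
Qed.

(** * Pigeonholes for the robber *)

(** Each of the k cops spoils one of the n options. *)
Lemma fewer_values n k (f : 'I_k -> 'I_n) : k < n -> exists a, forall i, f i != a.
Proof.
move=> kn; have /subsetPn[a _ fa] : ~~ ([set: 'I_n] \subset codom f).
  apply/negP => /subset_leq_card; rewrite cardsT card_ord leqNgt.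
  by rewrite (leq_ltn_trans (leq_image_card f _)) ?card_ord.
by exists a => i; apply: contraNneq fa => <-; apply: codom_f.
Qed.

Lemma fresh_nat k (f : 'I_k -> nat) : exists z, forall i, f i < z.
Proof. by exists (\max_i f i).+1 => i; rewrite ltnS leq_bigmax. Qed.

(** The option spoilt by a cop need not exist, nor be computable from the cop;
it only has to be unique. *)
Lemma fresh_index k (P : 'I_k -> nat -> Prop) :
  (forall i j j', P i j -> P i j' -> j = j') ->
  exists z, forall i j, P i j -> j < z.
Proof.
move=> uniqP.
have /boolp.choice[f fP] : forall i, exists j0, forall j, P i j -> j = j0.
  move=> i; have [[j0 Pj0]|noP] := pselect (exists j, P i j).
    by exists j0 => j Pj; apply: uniqP Pj Pj0.
  by exists 0 => j Pj; case: noP; exists j.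
have [z fz] := fresh_nat f; exists z => i j Pj; by rewrite (fP i j Pj).
Qed.

(** * Robbers that are never caught *)

Section Evasion.
Variables (G : connected_graph) (n : nat).

(** A positional escape plan: [safe c x] says that the robber can afford to stand
at [x] when it is the turn of cops standing at [c]. Only the cops' speed is
used, so such a plan beats every strategy, whatever it remembers. *)
Definition evasion (sigma rho psi R : nat) (v : G) : Prop :=
  exists safe : cops G n -> G -> Prop,
  [/\ forall c, exists x, safe c x,
      forall c x, safe c x -> dist v x <= R
    & forall c c' x, safe c x -> (forall i, dist (c i) (c' i) <= sigma) ->
        (forall i, rho < dist x (c' i)) /\
        exists2 y, robber_move rho psi c' x y & safe c' y].

(** Unlike the robber's replies, the cops' moves depend on the whole history, so
the play is built together with its history. *)
Lemma evasion_not_CopWin sigma rho psi R v :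
  evasion sigma rho psi R v -> ~ CopWin G n sigma rho psi R.
Proof.
move=> [safe [safe0 safeR safeS]] /(_ v)[S [legal win]].
have [x0 x0P] := safe0 (start S).
have /boolp.choice[flee fleeP] : forall q : cops G n * G * cops G n, exists y,
    safe q.1.1 q.1.2 -> (forall i, dist (q.1.1 i) (q.2 i) <= sigma) ->
    robber_move rho psi q.2 q.1.2 y /\ safe q.2 y.
  move=> [[c x] c'] /=.
  have [[sx cc']|nsx] := pselect (safe c x /\ forall i, dist (c i) (c' i) <= sigma).
    by have [_ [y]] := safeS _ _ _ sx cc'; exists y.
  by exists x => sx cc'; case: nsx.
pose next (s : seq (cops G n * G) * (cops G n * G)) :=
  let h := rcons s.1 s.2 in (h, (move S h, flee (s.2, move S h))).
pose s k := iter k next ([::], (start S, x0)).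
pose c k := (s k).2.1; pose r k := (s k).2.2.
have hist k : (s k).1 = mkseq (fun j => (c j, r j)) k.
  by elim: k => // k IHk; rewrite mkseqS -IHk -surjective_pairing.
have cS k : c k.+1 = move S (rcons (s k).1 (c k, r k)).
  by rewrite -surjective_pairing.
have rS k : r k.+1 = flee ((c k, r k), c k.+1).
  by rewrite cS -surjective_pairing.
have close k i : dist (c k i) (c k.+1 i) <= sigma by rewrite cS.
have safe_k k : safe (c k) (r k).
  elim: k => // k IHk; rewrite rS.
  by case: (fleeP ((c k, r k), c k.+1) IHk (close k)).
have [||[k [i]]|[N _ /(_ N (leqnn N))]] := win c r.
- split=> // k; rewrite cS; congr (move S _).
  by rewrite hist mkseqS.
- move=> k _; rewrite rS.
  by case: (fleeP ((c k, r k), c k.+1) (safe_k k) (close k)).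
- by rewrite leqNgt; case: (safeS _ _ _ (safe_k k) (close k)) => ->.
- by rewrite ltnNge (safeR _ _ (safe_k N)).
Qed.

End Evasion.

Lemma walk_along (G : graph) (f : nat -> G) d :
  (forall s, s < d -> adj (f s) (f s.+1)) ->
  exists p, [/\ path_from_to (f 0) (f d) p, size p = d
    & forall j, j <= d -> nth (f 0) (f 0 :: p) j = f j].
Proof.
elim: d f => [|d IHd] f adjf; first by exists [::]; split=> // -[].
have f01 : adj (f 0) (f 1) by apply: adjf.
have [s sd|p [[fp last_p] size_p nth_p]] := IHd (f \o succn); first exact: adjf.
exists (f 1 :: p); split=> [||[//|j] jp /=]; rewrite /= ?size_p //.
  by split; [rewrite /= f01 | exact: last_p].
by rewrite (set_nth_default (f 1)) /= ?size_p //; exact: (nth_p j jp).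
Qed.

Lemma dist_le_along (G : connected_graph) (f : nat -> G) d :
  (forall s, s < d -> adj (f s) (f s.+1)) -> dist (f 0) (f d) <= d.
Proof. by case/walk_along=> p [/dist_le_walk le_p size_p _]; rewrite size_p in le_p. Qed.

Lemma robber_move_along (G : connected_graph) n rho psi (c : cops G n)
    (f : nat -> G) d :
  d <= psi -> (forall s, s < d -> adj (f s) (f s.+1)) ->
  (forall s i, s <= d -> rho < dist (f s) (c i)) ->
  robber_move rho psi c (f 0) (f d).
Proof.
move=> d_psi /walk_along[p [fp size_p nth_p]] avoid; exists p.
by split; rewrite ?size_p // => j jd i; rewrite nth_p //; apply: avoid.
Qed.

(** A robber who stays in a retract may replace each cop by its retraction, which
is no slower and never farther from him. *)
Lemma evasion_retract (G H : connected_graph) (inj : H -> G) (ret : G -> H) n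
    sigma rho psi R (v : H) :
  cancel inj ret -> (forall x y, adj x y -> adj (inj x) (inj y)) ->
  (forall u w, adj u w -> ret u = ret w \/ adj (ret u) (ret w)) ->
  evasion n sigma rho psi R v -> evasion n sigma rho psi R (inj v).
Proof.
move=> injK inj_adj ret_adj [safe [safe0 safeR safeS]].
have distR x c : dist x (ret c) <= dist (inj x) c.
  by rewrite -{1}(injK x); apply: contraction_dist.
exists (fun c x => exists2 y, x = inj y & safe (ret \o c) y); split.
- by move=> c; have [y] := safe0 (ret \o c); exists (inj y); exists y.
- move=> c _ [y -> /safeR]; apply: leq_trans; apply: contraction_dist.
  by move=> u w /inj_adj; right.
- move=> c c' _ [y -> sy] cc'.
  have cc i : dist ((ret \o c) i) ((ret \o c') i) <= sigma.
    exact: leq_trans (contraction_dist _ _ ret_adj) (cc' i).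
  have [uncaught [z [p [[yp <-] size_p avoid]] sz]] := safeS _ _ _ sy cc.
  split; first by move=> i; apply: leq_trans (uncaught i) (distR _ _).
  exists (inj (last y p)); last by eexists.
  exists (map inj p); split; last 1 first.
  + rewrite size_map => j jp i; rewrite -map_cons (nth_map y) //.
    exact: leq_trans (avoid j jp i) (distR _ _).
  + split; last by rewrite last_map.
    elim: p y yp {sy uncaught size_p avoid sz} => //= w p IHp y.
    by move=> /andP[/inj_adj-> /IHp].
  + by rewrite size_map.
Qed.

(** The reach contributes only that the robber never steps on a cop. *)
Lemma robber_confined (G : connected_graph) n rho psi (c : cops G n)
    (A : G -> Prop) (x y : G) :
  A x -> (forall u v, A u -> adj u v -> (forall i, v <> c i) -> A v) ->
  robber_move rho psi c x y -> A y.
Proof.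
move=> Ax closed [p [xp _ avoid]].
apply: (walk_stays (ok := fun u => forall i, u <> c i)) Ax _ xp _.
  by move=> u v Au _ uv okv; apply: closed uv okv.
by move=> j jp i jc; have := avoid j jp i; rewrite jc dist_refl.
Qed.

(** * Cops with a memory *)

(** Describes a strategy by a memory updated with the robber's position only.
Legality is demanded on all histories, including those in which the cops do not
stand where their memory puts them; on such histories the strategy stays put
when it cannot reach the prescribed position. *)
Lemma automaton_CopWin (G : connected_graph) n sigma rho psi R (Q : Type)
    (q0 : Q) (pos : Q -> cops G n) (next : Q -> G -> Q) :
  (forall q r i, dist (pos q i) (pos (next q r) i) <= sigma) ->
  (forall (v : G) (q : nat -> Q) (r : nat -> G),
    q 0 = q0 -> (forall k, q k.+1 = next (q k) (r k)) ->
    (forall k i, rho < dist (r k) (pos (q k.+1) i)) ->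
    (forall k, robber_move rho psi (pos (q k.+1)) (r k) (r k.+1)) ->
    exists N, forall k, N <= k -> R < dist v (r k)) ->
  CopWin G n sigma rho psi R.
Proof.
move=> slow win v.
pose state (h : seq (cops G n * G)) := foldl next q0 (map snd h).
pose step (h : seq (cops G n * G)) : cops G n := fun i =>
  let: x := (last (pos q0, v) h).1 i in let: y := pos (state h) i in
  if dist x y <= sigma then y else x.
exists (Strategy (pos q0) step); split=> [h c r i /=|c r [/= c0 cS] plays].
  by rewrite /step last_rcons /=; case: ifP; rewrite ?dist_refl.
pose q k := state (mkseq (fun j => (c j, r j)) k).
have qS k : q k.+1 = next (q k) (r k).
  by rewrite /q /state mkseqS map_rcons foldl_rcons.
have ck k : c k = pos (q k).
  case: k => // k; rewrite cS; apply: funext => i; rewrite /step.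
  elim: k i => [|k IHk] i; first by rewrite /= c0 slow.
  rewrite -/(q k.+2) mkseqS last_rcons /= cS {1}/step.
  by rewrite qS; move: (IHk i); rewrite /step => ->; rewrite slow.
have [|free] := pselect (exists k, captured rho c r k); first by left.
right; have [|k i|k|N far] := win v q r _ qS.
- by [].
- by rewrite -ck ltnNge; apply/negP => close; apply: free; exists k, i.
- by rewrite -ck; apply: plays => j _ cap; apply: free; exists j.
- by exists N.+1 => // k Nk; apply/far/ltnW.
Qed.

(** * The wedge of stars at all scales *)

Section Bouquet.
Variables (X : connected_graph) (root : X) (n : nat).

(** [Spoke z a i j] lies on the spoke from star [z] to hub [a] in the piece of
scale [i + j]; [i] counts the steps back to the spoke's outer end, next to the
hub, and [j] those to the clique in the middle of the star. Keeping both makes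
every pair of numbers a vertex, with no bound to carry around. *)
Inductive bouquet_vertex :=
| Ext of X
| Hub of nat & 'I_n.+1
| Spoke of nat & 'I_n.+1 & nat & nat.

Inductive edge : bouquet_vertex -> bouquet_vertex -> Prop :=
| EdgeExt x y : adj x y -> edge (Ext x) (Ext y)
| EdgeRoot m : edge (Ext root) (Hub m ord0)
| EdgeRim m z a : edge (Hub m a) (Spoke z a 0 m)
| EdgeSpoke z a i j : edge (Spoke z a i j.+1) (Spoke z a i.+1 j)
| EdgeCore z a b m : a <> b -> edge (Spoke z a m 0) (Spoke z b m 0).

Definition bouquet_adj : rel bouquet_vertex :=
  fun u v => `[< edge u v \/ edge v u >].

Lemma bouquet_adj_sym : symmetric bouquet_adj.
Proof. by move=> u v; apply: asbool_equiv_eq; tauto. Qed.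

Lemma bouquet_adj_irr : irreflexive bouquet_adj.
Proof.
have irr u v : edge u v -> u <> v.
  case=> [x y xy [exy]|||z a i j []|z a b m ab []] //; last by lia.
  by rewrite exy adj_irr in xy.
by move=> u; apply/asboolP; case=> /irr.
Qed.

Definition bouquet_graph := Graph bouquet_adj_sym bouquet_adj_irr.

Lemma adj_edge (u v : bouquet_graph) : edge u v -> adj u v.
Proof. by move=> uv; apply/asboolP; left. Qed.

Lemma edge_adj (u v : bouquet_graph) : adj u v -> edge u v \/ edge v u.
Proof. by move/asboolP. Qed.

Lemma bouquet_connected : connected bouquet_graph.
Proof.
pose r : bouquet_graph := Ext root.
have up (u v : bouquet_graph) : edge u v -> reach u r -> reach v r.
  by move=> /adj_edge uv; apply: reach_trans; apply: reach_adj; rewrite adj_sym.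
have down (u v : bouquet_graph) : edge u v -> reach v r -> reach u r.
  by move=> /adj_edge uv; apply/reach_trans/reach_adj.
have hub0 m : reach (Hub m ord0 : bouquet_graph) r.
  by apply: up (EdgeRoot m) _; apply: reach_refl.
have spoke0 z i j : reach (Spoke z ord0 i j : bouquet_graph) r.
  elim: i j => [|i IHi] j; first by apply: up (EdgeRim _ _ _) _.
  by apply: up (EdgeSpoke _ _ _ _) _.
have spoke z a i j : reach (Spoke z a i j : bouquet_graph) r.
  elim: j i => [|j IHj] i; last by apply: down (EdgeSpoke _ _ _ _) _.
  have [->//|/eqP a0] := eqVneq a ord0.
  exact: down (EdgeCore z i a0) _.
apply: (@connected_from _ r) => -[x|m a|z a i j] //.
- have [p [xp xr]] := (connectedP X).2 x root; exists (map Ext p); split.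
    elim: p x xp {xr} => //= y p IHp x /andP[xy /IHp ->].
    by rewrite andbT; apply/adj_edge/EdgeExt.
  by rewrite last_map xr.
- exact: down (EdgeRim m 0 a) _.
Qed.

Definition bouquet := ConnectedGraph bouquet_connected.

Definition retract (u : bouquet) : X := if u is Ext x then x else root.

Lemma retract_adj (u v : bouquet) :
  adj u v -> retract u = retract v \/ adj (retract u) (retract v).
Proof.
move/edge_adj => [] []; intros;
  by first [by left | by right | by right; rewrite /= adj_sym].
Qed.

Lemma Ext_adj x y : adj x y -> adj (Ext x : bouquet) (Ext y : bouquet).
Proof. by move=> xy; apply/adj_edge/EdgeExt. Qed.

(** The way from hub [a] to hub [b] through star [z], of length [m.*2.+3]. It is
constant from there on. *)
Definition run m (a b : 'I_n.+1) z s : bouquet :=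
  if s == 0 then Hub m a
  else if s <= m.+1 then Spoke z a s.-1 (m.+1 - s)
  else if s <= m.*2.+2 then Spoke z b (m.*2.+2 - s) (s - m.+2)
  else Hub m b.

Lemma run_start m a b z : run m a b z 0 = Hub m a.
Proof. by []. Qed.

Lemma run_end m a b z : run m a b z m.*2.+3 = Hub m b.
Proof. by rewrite /run !ifF //; lia. Qed.

Lemma run_near m a b z i : i <= m -> run m a b z i.+1 = Spoke z a i (m - i).
Proof. by move=> im; rewrite /run /= ltnS im subSS. Qed.

Lemma run_far m a b z j : j <= m -> run m a b z (m.+2 + j) = Spoke z b (m - j) j.
Proof.
move=> jm; rewrite /run.
have /negbTE-> : m.+2 + j != 0 by lia.
have /negbTE-> : ~~ (m.+2 + j <= m.+1) by lia.
have -> : m.+2 + j <= m.*2.+2 by lia.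
by rewrite addKn (_ : m.*2.+2 - (m.+2 + j) = m - j) //; lia.
Qed.

Lemma run_adj m a b z s :
  a <> b -> s < m.*2.+3 -> adj (run m a b z s) (run m a b z s.+1).
Proof.
move=> ab s_len; case: s s_len => [|s] s_len.
  by rewrite run_near // subn0; apply/adj_edge/EdgeRim.
have [sm|ms] := ltnP s m.
  rewrite run_near 1?ltnW // run_near // -(subnSK sm).
  exact/adj_edge/EdgeSpoke.
have [j s_eq] : exists j, s = m + j by exists (s - m); lia.
rewrite {s ms}s_eq in s_len *; case: j s_len => [|j] s_len.
  rewrite addn0 run_near // subnn -[m.+2]addn0 run_far // subn0.
  exact/adj_edge/EdgeCore.
rewrite (_ : (m + j.+1).+1 = m.+2 + j) ?run_far; try lia.
have [jm|mj] := ltnP j m.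
  by rewrite -addnS run_far // -(subnSK jm) adj_sym; exact/adj_edge/EdgeSpoke.
have {mj s_len} -> : j = m by lia.
rewrite (_ : (m.+2 + m).+1 = m.*2.+3) ?run_end ?subnn 1?adj_sym; last lia.
exact/adj_edge/EdgeRim.
Qed.

End Bouquet.

Arguments Ext {X n}.
Arguments Hub {X n}.
Arguments Spoke {X n}.
Arguments run {X} root {n}.

(** * Fewer cops than hubs *)

Section LowerBound.
Variables (X : connected_graph) (root : X) (n : nat).
Notation B := (bouquet root n).

(** Hub [a] together with its spokes up to the middle of the stars. The rest of
the graph is attached to hub [ord0], hence counted on its side. *)
Definition side m (u : B) : 'I_n.+1 :=
  match u with
  | Ext _ => ord0
  | Hub l a => if l == m then a else ord0
  | Spoke _ a i j => if i + j == m then a else ord0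
  end.

(** Distance that must be covered to leave a side, capped where it grows further. *)
Definition depth m (u : B) : nat :=
  if u is Spoke _ _ i j then if i + j == m then j.+1 else m.+2 else m.+2.

Lemma far_from_hub m a (u : B) : side m u != a -> m.+2 <= dist u (Hub m a).
Proof.
move=> ua; pose f (v : B) := if side m v == a then depth m v else 0.
suff lip (v w : B) : edge root v w -> f v <= (f w).+1 /\ f w <= (f v).+1.
  have : f (Hub m a) <= f u + dist u (Hub m a).
    by apply: lipschitz_dist => v w /edge_adj[] /lip[].
  by rewrite /f /= !eqxx (negbTE ua).
rewrite /f; case=> {u ua v w} [x y _|l|l z b|z b i j|z b c l _] /=.
- by case: eqP; lia.
- by rewrite if_same; case: eqP; lia.
- by rewrite add0n; case: (l =P m) => ?; case: eqP; lia.
- by rewrite addSnnS; case: eqP; case: eqP; lia.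
- by rewrite addn0; case: (l =P m) => ?; do 2?case: eqP; lia.
Qed.

Definition star (u : B) : nat := if u is Spoke z _ _ _ then z else 0.

(** A cop outside star [z] reaches the run from behind, and then is late by the
distance [s] already covered, or from hub [b], which is far from him, or from a
third hub, and then has a whole spoke to walk first. *)
Lemma run_guard m a b z rho (u : B) s :
  a != b -> rho < dist u (Hub m a) -> side m u != b -> star u != z ->
  s <= m.*2.+3 -> minn m.+1 (rho.+1 + s) <= dist u (run root m a b z s).
Proof.
move=> ab u_a u_b u_z s_len.
pose S (v : B) := if v is Spoke y _ i j then (y == z) && (i + j == m) else false.
pose on (c : 'I_n.+1) t :=
  if c == a then minn m.+1 (rho.+1 + t) else if c == b then m.+1 else minn m.+1 t.
pose g (v : B) := match v with
  | Ext _ => 0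
  | Hub l c => if l == m then on c 0 else 0
  | Spoke y c i j => if S v then on c i.+1 else 0
  end.
have := @barrier_dist B S g u (run root m a b z s).
have ba : b == a = false by rewrite eq_sym (negbTE ab).
have -> : g (run root m a b z s) = minn m.+1 (rho.+1 + s).
  rewrite /run; case: eqP => [->|s0]; first by rewrite /= /on !eqxx.
  case: leqP => [sm|ms].
    rewrite /= (_ : s.-1 + (m.+1 - s) = m) ?eqxx /on ?eqxx ?prednK //; lia.
  rewrite (_ : minn m.+1 (rho.+1 + s) = m.+1); last by lia.
  case: leqP => sm; last by rewrite /= /on !eqxx ba.
  by rewrite /= (_ : _ - s + _ = m) ?eqxx /on ?eqxx ?ba //; lia.
apply.
- by case: u u_z {u_a u_b} => //= y c i j /negbTE->.
- case=> [x|l c|y c i j] //= Sv; last by move/negP/negbTE: Sv => ->.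
  case: eqP => // ->; rewrite /on; case: eqP => [->|_]; first by lia.
  case: eqP => [->|_]; last by lia.
  by apply: leq_trans (far_from_hub u_b); lia.
- have slow c t t' : t' <= t.+1 -> on c t' <= (on c t).+1.
    by rewrite /on; do 2?case: eqP => _; lia.
  have core c c' : on c' m.+1 <= (on c m.+1).+1.
    by rewrite /on; do 4?case: eqP => _; lia.
  move=> v w /edge_adj[] [] {v w} //=.
  + by move=> l y c /andP[-> ->]; exact: slow.
  + by move=> y c i j Sw; rewrite addnS -addSn Sw; apply: slow.
  + by move=> y c c' l _ /[dup] /andP[_ /eqP]; rewrite addn0 => -> ->.
  + by move=> y c i j Sw; rewrite addSn -addnS Sw; apply: slow; lia.
  + by move=> y c c' l _ /[dup] /andP[_ /eqP]; rewrite addn0 => -> ->.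
Qed.

(** The robber's positions are of two kinds: waiting on a hub, or running. A running
robber remembers through [departed] where the cops stood when he left, and how
little they have moved since. *)
Theorem bouquet_not_strong k : k < n.+1 -> ~ strong_cop_win (bouquet root n) k.
Proof.
move=> kn [sigma sigma_gt0 /(_ (4 * sigma))].
rewrite muln_gt0 => /(_ sigma_gt0)[rho win].
(* A cop farther than tau cannot catch the robber at its next move. A run of
   length W lasts about W / (4 * sigma) turns, in which a cop covers about m / 2;
   m is chosen so that tau still remains. *)
pose tau := rho + sigma; pose m := tau.*2.+2; pose W := m.*2.+3.
suff ev : @evasion (bouquet root n) k sigma rho (4 * sigma) W.*2 (Hub m ord0).
  by apply: evasion_not_CopWin ev _; apply: win.
have along a b z s : a != b -> s <= W -> dist (Hub m a : B) (run root m a b z s) <= s.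
  move=> /eqP ab sW; apply: dist_le_along => t ts; apply: run_adj => //; lia.
pose departed (c0 : cops B k) a b z := forall i,
  [/\ rho < dist (c0 i) (Hub m a), side m (c0 i) != b & star (c0 i) != z].
pose running (c : cops B k) (x : B) e := exists a b z (c0 : cops B k),
  [/\ a != b, departed c0 a b z, forall i, dist (c0 i) (c i) <= sigma * e,
   x = run root m a b z (4 * sigma * e) & 4 * sigma * e < W].
pose waiting (c : cops B k) (x : B) := exists2 a, x = Hub m a &
  forall i, tau < dist (c i) (Hub m a).
pose close (c c' : cops B k) := forall i, dist (c i) (c' i) <= sigma.
pose safe c x :=
  waiting c x \/ exists e, forall c', close c c' -> running c' x e.+1.
have keep_running c x e : running c x e -> (forall i, rho < dist x (c i)) /\
    exists2 y, robber_move rho (4 * sigma) c x y & safe c y.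
  case=> a [b] [z] [c0] [ab dep c0c -> eW].
  have guard s i : 4 * sigma * e <= s <= W -> rho < dist (run root m a b z s) (c i).
    move=> /andP[es sW]; have [ca cb cz] := dep i.
    have := run_guard ab ca cb cz sW.
    have := dist_triangle (c i) (c0 i) (run root m a b z s).
    rewrite [dist (c i) _]dist_sym; have := c0c i; rewrite /W in eW *; nia.
  split=> [i|]; first by apply: guard; rewrite leqnn ltnW.
  (* The length of the run need not be a multiple of the speed. *)
  pose s' := minn (4 * sigma * e.+1) W.
  exists (run root m a b z s').
    pose f s := run root m a b z (4 * sigma * e + s).
    have [d s'E] : exists d, s' = 4 * sigma * e + d by exists (s' - 4 * sigma * e); lia.
    rewrite s'E -[4 * sigma * e in X in robber_move _ _ _ X]addn0.
    apply: (@robber_move_along _ _ _ _ _ f); first by lia.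
      by move=> s sd; rewrite /f addnS; apply: run_adj; [apply/eqP | lia].
    by move=> s i sd; apply: guard; lia.
  have [eW'|We] := ltnP (4 * sigma * e.+1) W.
    right; exists e => c' cc'; exists a, b, z, c0; split=> //.
      move=> i; apply: leq_trans (dist_triangle (c i) _ _) _.
      by rewrite mulnS addnC leq_add.
    by rewrite /s' (minn_idPl _) // ltnW.
  left; exists b => [|i]; first by rewrite /s' (minn_idPr _) // run_end.
  have [_ /far_from_hub cb _] := dep i.
  have := dist_triangle (c i) (c0 i) (Hub m b); have := c0c i.
  rewrite /W /m in cb eW *; nia.
exists safe; split.
- move=> c; have [a ca] := fewer_values (fun i => side m (c i)) kn.
  exists (Hub m a); left; exists a => // i.
  by have := @far_from_hub m a (c i) (ca i); rewrite /m; lia.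
- have runs a b z s : a != b -> s <= W ->
      dist (Hub m ord0 : B) (run root m a b z s) <= W.*2.
    move=> ab sW; apply: leq_trans (@dist_triangle B (Hub m a) _ _) _.
    rewrite -addnn leq_add //; last exact: leq_trans (along _ _ _ _ ab sW) _.
    have [->|a0] := eqVneq a ord0; first by rewrite dist_refl.
    rewrite dist_sym -(run_end root m a ord0 0); exact: along.
  move=> c x [[a -> _]|[e /(_ c)[i|a [b] [z] [c0] [ab _ _ -> eW]]]].
  + have [->|a0] := eqVneq a ord0; first by rewrite dist_refl.
    rewrite -(run_start root m a ord0 0); exact: runs.
  + by rewrite dist_refl.
  + by apply: runs => //; apply: ltnW.
- move=> c c' x [[a -> ca]|[e run_e]] cc'; last by apply: keep_running (run_e _ cc').
  have ca' i : rho < dist (c' i) (Hub m a).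
    have := dist_triangle (c' i) (c i) (Hub m a); have := ca i; have := cc' i.
    by rewrite /tau; lia.
  have [[i near]|away] := pselect (exists i, dist (c' i) (Hub m a) <= tau).
    have [b cb] := fewer_values (fun i => side m (c' i)) kn.
    have [z cz] := fresh_nat (fun i => star (c' i)).
    apply: (keep_running _ _ 0); exists a, b, z, c'; split.
    + apply/eqP => ab; have := @far_from_hub m b (c' i) (cb i); rewrite -ab.
      have : m = tau.*2.+2 by []; lia.
    + by move=> j; split; rewrite ?cb // neq_ltn cz.
    + by move=> j; rewrite dist_refl.
    + by rewrite muln0.
    + by rewrite muln0.
  split=> [i|]; first by rewrite dist_sym.
  exists (Hub m a).
    exists [::]; split=> // -[] // _ i; by rewrite dist_sym.
  left; exists a => // i; rewrite ltnNge; apply/negP => near; apply: away.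
  by exists i.
Qed.

End LowerBound.

(** * As many cops as hubs *)

Section UpperBound.
Variables (X : connected_graph) (root : X) (n : nat).
Notation B := (bouquet root n).

(** One cop starting at [root] controls [X]: its k-th position is the shadow of the
robber's current position, and as long as the robber is free he remains too far from
the root to reach it in one move, and ends up leaving every ball. The predicate
[below k] records where a robber facing the k-th shadow can be. The condition on the
root is what allows other graphs to be attached there. *)
Record one_cop_herds (sigma rho psi : nat) (below : nat -> X -> Prop)
    (shadow : nat -> X -> X) : Prop := OneCopHerds {
  herd_start : forall x, below 0 x /\ dist root (shadow 0 x) <= sigma;
  herd_root : forall k x, below k x -> rho < dist x (shadow k x) ->
    psi < dist root x;
  herd_step : forall k x y, below k x -> rho < dist x (shadow k x) ->
    dist x y <= psi ->
    below k.+1 y /\ dist (shadow k x) (shadow k.+1 y) <= sigma;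
  herd_far : forall R, exists N, forall k x, N <= k -> below k x ->
    rho < dist x (shadow k x) -> R < dist root x }.

Lemma dist_Ext_le (x y : X) : dist (Ext x : B) (Ext y) <= dist x y.
Proof. by apply: contraction_dist => u v uv; right; apply: Ext_adj. Qed.

Lemma dist_Ext_ge (x y : X) : dist x y <= dist (Ext x : B) (Ext y).
Proof. exact: (@contraction_dist B X (@retract _ _ _) _ _ (@retract_adj _ _ _)). Qed.

(** The root is the only way out of [X]. *)
Lemma walk_in_Ext (x : X) (p : seq B) :
  path (@adj B) (Ext x) p -> size p < dist root x ->
  exists2 y, last (Ext x : B) p = Ext y & dist x y <= size p.
Proof.
elim: p x => [|v p IHp] x /=; first by exists x; rewrite ?dist_refl.
move=> /andP[xv vp] p_short; have x_root : x <> root.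
  by move=> x_root; rewrite x_root dist_refl in p_short.
have [x1 vE xx1] : exists2 x1, v = Ext x1 & adj x x1.
  move: xv => /edge_adj; move uE: (Ext x) => u [] uv.
    by case: uv uE => // [y z yz [->]|m [/x_root]] //; exists z.
  by case: uv uE => // y z yz [->]; exists y; rewrite // adj_sym.
rewrite {v}vE in vp xv *.
have [|y -> x1y] := IHp x1 vp.
  rewrite -ltnS; apply: leq_trans p_short _.
  apply: leq_trans (dist_triangle x1 root x) _.
  by rewrite -addn1 leq_add2l dist_sym dist_adj.
exists y => //; apply: leq_trans (dist_triangle x1 x y) _.
by rewrite -add1n leq_add ?dist_adj.
Qed.

(** [Spread m t]: the cops have been walking for [t] turns to the hubs of scale
[m]. [Squeeze m z t]: they have been walking for [t] turns down the spokes of star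
[z]. [Herd k x]: all of them stand on the k-th shadow [x]. *)
Inductive cop_state :=
| Gather
| Herd of nat & X
| Spread of nat & nat
| Squeeze of nat & nat & nat.

Definition wall m z t (a : 'I_n.+1) : B :=
  if t is i.+1 then Spoke z a i (m - i) else Hub m a.

Definition position (q : cop_state) : cops B n.+1 := fun a =>
  match q with
  | Gather => Ext root
  | Herd _ y => Ext y
  | Spread m t =>
      (* Cop [ord0] locks the root until the other hubs are all held, which takes
         one step from the root to hub [ord0] and then a run. *)
      if a == ord0 then if t <= m.*2.+3 then Ext root else Hub m ord0
      else if t is s.+1 then run root m ord0 a 0 s else Ext root
  | Squeeze m z t => wall m z t a
  end.

Definition next_state sigma (shadow : nat -> X -> X) (q : cop_state) (r : B) :
    cop_state :=
  match q, r with
  | Gather, Ext x => Herd 0 (shadow 0 x)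
  | Gather, Hub m _ => Spread m 0
  | Gather, Spoke _ _ i j => Spread (i + j) 0
  | Herd k y, Ext x =>
      (* This holds in actual plays; the test makes every transition legal. *)
      if dist y (shadow k.+1 x) <= sigma then Herd k.+1 (shadow k.+1 x) else q
  | Spread m t, _ =>
      if t <= m.*2.+3 then Spread m t.+1
      else if r is Spoke z _ _ _ then Squeeze m z 1 else q
  | Squeeze m z t, _ => if t <= m then Squeeze m z t.+1 else q
  | _, _ => q
  end.

Lemma position_spread_end m t a :
  m.*2.+3 < t -> position (Spread m t) a = Hub m a.
Proof.
move=> mt; rewrite /position leqNgt mt /=; case: eqP => [->//|_].
by case: t mt => // t mt; rewrite /run !ifF //; lia.
Qed.

Lemma wall_adj m z t a : t <= m -> adj (wall m z t a) (wall m z t.+1 a).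
Proof.
case: t => [|t] tm; first by rewrite /= subn0; apply/adj_edge/EdgeRim.
by rewrite /= -(subnSK tm); apply/adj_edge/EdgeSpoke.
Qed.

Lemma cops_slow sigma shadow q r a :
  0 < sigma -> (forall x, dist root (shadow 0 x) <= sigma) ->
  dist (position q a) (position (next_state sigma shadow q r) a) <= sigma.
Proof.
move=> sigma_gt0 start.
have stay (u : B) : dist u u <= sigma by rewrite dist_refl.
have step (u v : B) : adj u v -> dist u v <= sigma.
  by move=> /dist_adj uv; apply: leq_trans uv sigma_gt0.
case: q => [|k y|m t|m z t].
- case: r => [x|m b|z b i j] /=; rewrite ?if_same //.
  exact: leq_trans (dist_Ext_le _ _) _.
- case: r => [x|m b|z b i j] //=; case: ifP => // close.
  exact: leq_trans (dist_Ext_le _ _) _.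
- have [tm|mt] := leqP t m.*2.+3; last first.
    have hub := position_spread_end a mt.
    rewrite /next_state [t <= _]leqNgt mt hub.
    case: r => [x|l b|z b i j]; rewrite ?hub //.
    by apply: step; apply: (@wall_adj m z 0).
  rewrite /next_state tm /= tm; case: eqP => [_|/eqP a0].
    by case: ifP => // _; apply/step/adj_edge/EdgeRoot.
  case: t tm => [|s] sm; first by apply/step/adj_edge/EdgeRoot.
  by apply/step/run_adj => // ea; rewrite ea eqxx in a0.
- by rewrite /next_state; case: ifP => // tm; apply/step/wall_adj.
Qed.

Definition in_scale m (u : B) : Prop :=
  match u with Ext _ => False | Hub l _ => l = m | Spoke _ _ i j => i + j = m end.

(** The part of star [z] enclosed by the cops at [wall m z t]. *)
Definition inside m z t (u : B) : Prop :=
  if u is Spoke y _ i j then [/\ y = z, i + j = m & t <= i] else False.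

Lemma in_scale_closed m (u v : B) :
  in_scale m u -> adj u v -> v <> Ext root -> in_scale m v.
Proof.
move=> u_in /edge_adj[] uv; case: uv u_in => *; simpl in *;
  by (congruence || lia).
Qed.

Lemma inside_closed m z t (u v : B) :
  inside m z t u -> adj u v -> (forall a, v <> wall m z t a) -> inside m z t v.
Proof.
move=> u_in /edge_adj[] uv; case: uv u_in => //=.
- by move=> y a i j [-> <- ti] _; split=> //; lia.
- by move=> l y a [_ <-]; case: t => // _ /(_ a).
- move=> y a i j [-> <- ti] off; split=> //; try lia.
  rewrite leqNgt; apply/negP => it; apply: (off a).
  by rewrite (_ : t = i.+1) /=; [congr Spoke; lia | lia].
Qed.

(** The cops close in by one step without letting the robber through. *)
Lemma inside_step m z t (u : B) :
  inside m z t u -> (forall a, u <> wall m z t.+1 a) -> inside m z t.+1 u.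
Proof.
case: u => //= y a i j [-> <- ti] off; split=> //; rewrite ltn_neqAle ti andbT.
by apply/eqP => it; apply: (off a); rewrite it addKn.
Qed.

(** The invariant just after the cops' move. It precedes the test for capture, so
the robber is only known to be inside the previous wall. *)
Definition chasing (q : cop_state) (r : B) : Prop :=
  match q with
  | Spread m t => in_scale m r
  | Squeeze m z t.+1 => inside m z t r
  | _ => False
  end.

(** Bounds the turns left before capture: the walk to the hubs, then the spokes. *)
Definition remaining (q : cop_state) : nat :=
  match q with
  | Spread m t => m.*2.+4 - t + m.+2
  | Squeeze m _ t => m.+2 - t
  | _ => 0
  end.

Lemma chasing_step sigma shadow rho psi q (r r' : B) :
  chasing q r -> (forall a, rho < dist r (position q a)) ->
  robber_move rho psi (position q) r r' ->
  chasing (next_state sigma shadow q r') r' /\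
  remaining (next_state sigma shadow q r') < remaining q.
Proof.
move=> chase free moves.
have {free} off a : r <> position q a.
  by move=> ra; have := free a; rewrite ra dist_refl.
case: q chase off moves => [|k y|m t|m z [|t]] //= chase off moves.
- have [tm|mt] := leqP t m.*2.+3.
    split; last by rewrite /=; lia.
    apply: robber_confined chase _ moves => u v us uv okv.
    apply: in_scale_closed us uv _; have := okv ord0; by rewrite /= tm.
  have hubs a : position (Spread m t) a = Hub m a by apply: position_spread_end.
  have [z zr] : exists z, inside m z 0 r.
    case: r chase off {moves} => [x|l a|z a i j] //= => [->|ij] off; last by exists z.
    by case: (off a); rewrite -hubs.
  have {zr} : inside m z 0 r'.
    apply: robber_confined zr _ moves => u v uz uv okv.
    by apply: inside_closed uz uv _ => a; rewrite -[wall _ _ _ _]hubs; apply: okv.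
  case: r' {moves} => //= y a i j [-> ij _]; split=> //; lia.
- have {off} zr := inside_step chase off.
  have {moves} : inside m z t.+1 r'.
    apply: robber_confined zr _ moves => u v uz uv okv.
    exact: inside_closed uz uv okv.
  case: ifP => tm zr'; first by split=> //=; lia.
  by case: r' zr' => //= y a i j []; lia.
Qed.

Theorem bouquet_CopWin sigma rho psi below shadow R :
  0 < sigma -> one_cop_herds sigma rho psi below shadow ->
  CopWin B n.+1 sigma rho psi R.
Proof.
move=> sigma_gt0 [start rootP step far].
have start_close x : dist root (shadow 0 x) <= sigma by case: (start x).
apply: (@automaton_CopWin B _ _ _ _ _ cop_state Gather position
  (next_state sigma shadow)) => [q r a|v q r q0 qS free moves].
  exact: cops_slow.
have [[x0 r0]|chase0] : (exists x, r 0 = Ext x) \/ chasing (q 1) (r 0).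
- by rewrite qS q0; case: (r 0) => [x|m a|z a i j]; [left; exists x | right | right].
- have herd k : exists x, [/\ r k = Ext x, below k x & q k.+1 = Herd k (shadow k x)].
    elim: k => [|k [x [rk xk qk]]].
      by exists x0; rewrite qS q0 r0; case: (start x0).
    have x_free : rho < dist x (shadow k x).
      have := free k ord0; rewrite rk qk => /leq_trans; apply; exact: dist_Ext_le.
    have [p [[rp p_last] p_psi _]] := moves k; rewrite rk in rp p_last.
    have [y ry xy] := walk_in_Ext rp (leq_ltn_trans p_psi (rootP _ _ xk x_free)).
    have [yk xy_close] := step _ _ _ xk x_free (leq_trans xy p_psi).
    by exists y; rewrite qS qk -p_last ry /= xy_close.
  have [N farN] := far (R + dist (Ext root : B) v).
  exists N => k Nk; have [x [rk xk qk]] := herd k; have := free k ord0.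
  rewrite rk qk => /leq_trans/(_ (dist_Ext_le _ _))/(farN _ _ Nk xk) Rx.
  have := dist_triangle v (Ext root : B) (Ext x); have := dist_Ext_ge root x.
  by lia.
- have chase k : chasing (q k.+1) (r k) /\ remaining (q k.+1) + k <= remaining (q 1).
    elim: k => [|k [IHk le_k]]; first by rewrite addn0.
    rewrite qS; have [] := chasing_step sigma shadow IHk (free k) (moves k).
    by split=> //; lia.
  by have [_] := chase (remaining (q 1)).+1; lia.
Qed.

End UpperBound.

(** * The cone *)

Section Cone.

Definition cone_vertex := (nat * (nat -> nat))%type.
Implicit Types u v : cone_vertex.

Definition adjacent_values (a b : nat) := (a <= b.+1) && (b <= a.+1).

Definition parent (u : cone_vertex) : cone_vertex := (u.1.-1, fun i => (u.2 i)./2).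

(** Level 0 is complete, which makes the cone connected although sequences may be
at infinite distance from each other in the sup metric. *)
Definition cone_edge u v : Prop :=
  (0 < u.1 /\ v = parent u) \/
  [/\ u.1 = v.1, u <> v & 0 < u.1 -> forall i, adjacent_values (u.2 i) (v.2 i)].

Definition cone_adj : rel cone_vertex :=
  fun u v => `[< cone_edge u v \/ cone_edge v u >].

Lemma cone_adj_sym : symmetric cone_adj.
Proof. by move=> u v; apply: asbool_equiv_eq; tauto. Qed.

Lemma cone_adj_irr : irreflexive cone_adj.
Proof.
have irr u : ~ cone_edge u u.
  by case: u => k f [[/= k_gt0 [/eqP]]|[_ []//]]; lia.
by move=> u; apply/asboolP => -[/irr|/irr].
Qed.

Definition cone_graph := Graph cone_adj_sym cone_adj_irr.

Definition apex : cone_graph := (0, fun=> 0).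

Definition ancestor k (u : cone_graph) : cone_graph :=
  (k, fun i => u.2 i %/ 2 ^ (u.1 - k)).

Lemma parent_adj (u : cone_graph) : 0 < u.1 -> adj u (parent u : cone_graph).
Proof. by move=> u_gt0; apply/asboolP; left; left. Qed.

Lemma horizontal_adj (u v : cone_graph) :
  u.1 = v.1 -> (0 < u.1 -> forall i, adjacent_values (u.2 i) (v.2 i)) ->
  u = v \/ adj u v.
Proof.
move=> uv near; have [|nuv] := pselect (u = v); first by left.
by right; apply/asboolP; left; right.
Qed.

Lemma ancestor_parent k (u : cone_graph) :
  k < u.1 -> ancestor k (parent u) = ancestor k u.
Proof.
case: u => -[//|l] f kl; rewrite /ancestor; congr pair; apply: funext => i /=.
by rewrite subSn // expnS divnMA divn2.
Qed.

Lemma ancestor_id (u : cone_graph) : ancestor u.1 u = u.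
Proof.
by case: u => k f; congr pair; apply: funext => i /=; rewrite subnn divn1.
Qed.

Lemma ancestor_trans k l (u : cone_graph) :
  k <= l <= u.1 -> ancestor k (ancestor l u) = ancestor k u.
Proof.
move=> /andP[kl lu]; congr pair; apply: funext => i /=.
by rewrite -divnMA -expnD; congr (_ %/ 2 ^ _); lia.
Qed.

Lemma climb (u : cone_graph) k : k <= u.1 ->
  exists p, path_from_to u (ancestor k u) p /\ size p = u.1 - k.
Proof.
elim: {u}_.+1 {-2}u (ltnSn u.1) => // d IHd u ud ku.
have [->|lt_ku] := eqVneq k u.1; first by exists [::]; rewrite ancestor_id subnn.
have {lt_ku} lt_ku : k < u.1 by rewrite ltn_neqAle lt_ku.
have [||p [[up p_last] size_p]] := IHd (parent u); rewrite /=; try lia.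
exists ((parent u : cone_graph) :: p); split; last by rewrite /= size_p /=; lia.
split; first by rewrite /= up andbT; apply: parent_adj; lia.
by rewrite /= p_last ancestor_parent.
Qed.

Lemma cone_connected : connected cone_graph.
Proof.
apply: (@connected_from _ apex) => u.
have [p [up _]] := climb (leq0n u.1); apply: (@reach_trans _ _ (ancestor 0 u)).
  by exists p.
have [//|//|->|] := @horizontal_adj (ancestor 0 u) apex; first exact: reach_refl.
exact: reach_adj.
Qed.

Definition cone := ConnectedGraph cone_connected.

Lemma dist_ancestor (u : cone) k : k <= u.1 -> dist u (ancestor k u : cone) <= u.1 - k.
Proof. by case/climb => p [/(@dist_le_walk cone) + <-]. Qed.

Lemma dist_horizontal (u v : cone) :
  u.1 = v.1 -> (0 < u.1 -> forall i, adjacent_values (u.2 i) (v.2 i)) ->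
  dist u v <= 1.
Proof.
by move=> uv /(horizontal_adj uv)[->|/(@dist_adj cone)]; rewrite ?dist_refl.
Qed.

Lemma dist_apex_le (u : cone) : dist (apex : cone) u <= u.1.+1.
Proof.
rewrite dist_sym; apply: leq_trans (dist_triangle (ancestor 0 u : cone) _ _) _.
rewrite -addn1 leq_add ?dist_horizontal //.
by apply: leq_trans (dist_ancestor _) _; rewrite ?subn0.
Qed.

Lemma level_dist (u v : cone) : v.1 <= u.1 + dist u v.
Proof.
apply: (@lipschitz_dist cone (fun w => w.1)) => {u v} u v /asboolP.
by case=> [] [[gt0 ->]|[-> _ _]] /=; lia.
Qed.

Lemma quotient_step a b d : a <= b + 2 ^ d -> a %/ 2 ^ d <= (b %/ 2 ^ d).+1.
Proof.
move=> ab; apply: leq_trans (leq_div2r _ ab) _.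
by rewrite divnDr // divnn expn_gt0 addn1.
Qed.

Lemma ancestor_step l (u v : cone) :
  0 < l <= u.1 -> l <= v.1 -> adj u v ->
  forall i, adjacent_values ((ancestor l u).2 i) ((ancestor l v).2 i).
Proof.
move=> /andP[l_gt0 lu] lv /asboolP uv i.
wlog {uv} : u v lu lv / cone_edge u v.
  by move=> wl; case: uv => uv; [|rewrite /adjacent_values andbC]; apply: wl.
case=> [[u_gt0 vE]|[uv _ near]].
  have -> : ancestor l v = ancestor l u.
    by rewrite vE ancestor_parent //; rewrite vE /= in lv; lia.
  by rewrite /adjacent_values leqnSn.
have /andP[ab ba] := near (leq_trans l_gt0 lu) i.
have pow_gt0 : 0 < 2 ^ (v.1 - l) by rewrite expn_gt0.
by rewrite /adjacent_values /= uv !quotient_step //; lia.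
Qed.

Definition values_within (f g : nat -> nat) d :=
  forall i, f i <= g i + d /\ g i <= f i + d.

(** A walk of length [d] that starts at least [d] levels below [l] never rises above
[l], and so moves the ancestor at level [l] by at most one at each step. *)
Lemma ancestor_lipschitz l d (u v : cone) :
  0 < l -> dist u v <= d -> l + d <= u.1 ->
  values_within (ancestor l u).2 (ancestor l v).2 d.
Proof.
move=> l_gt0; have [p [[up <-] <-]] := dist_walk u v.
elim: p u d up => [|w p IHp] u d; first by move=> _ _ _ i /=; rewrite leq_addr.
case: d => // d /andP[uw wp] pd lu i.
have wu : l + d <= w.1.
  have := leq_trans lu (level_dist w u); have := @dist_adj cone _ _ uw.
  by rewrite dist_sym; lia.
have [] := IHp w d wp pd wu i.
have lev : 0 < l <= u.1 by lia.
have lw : l <= w.1 by lia.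
have /andP[] := ancestor_step lev lw uw i.
move: ((ancestor l u).2 i) ((ancestor l w).2 i) ((ancestor l (last w p)).2 i).
by move=> a b c; rewrite /=; lia.
Qed.

(** The shadows of the robber are his ancestors. Not being caught means being more
than [2 * psi] levels below the cop; a move keeps him [psi] levels below the
next one, where distances at most [psi] shrink to at most one. Going from an
ancestor to the next then takes a horizontal step and a step down. *)
Lemma cone_one_cop_herds psi :
  one_cop_herds (apex : cone) 2 psi.*2 psi (fun k u => k <= u.1) ancestor.
Proof.
have deep k (u : cone) :
    k <= u.1 -> psi.*2 < dist u (ancestor k u : cone) -> k + psi.*2 < u.1.
  by move=> ku far; have := leq_trans far (dist_ancestor ku); lia.
have apex_level (u : cone) : u.1 <= dist (apex : cone) u by apply: level_dist apex u.
split.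
- by move=> u; split=> //; apply: leq_trans (dist_apex_le _) _.
- by move=> k u ku /(deep _ _ ku) u_deep; have := apex_level u; lia.
- move=> k u v ku /(deep _ _ ku) u_deep uv.
  pose l := k.+1 + psi.
  have lu : l + psi <= u.1 by rewrite /l; lia.
  have kv : l <= v.1 by have := level_dist v u; rewrite dist_sym; lia.
  split; first by lia.
  have near := ancestor_lipschitz (ltn0Sn _) uv lu.
  apply: leq_trans (dist_triangle (ancestor k v : cone) _ _) _.
  have via w : l <= w.1 -> ancestor k w = ancestor k (ancestor l w).
    by move=> lw; rewrite ancestor_trans // lw /l; lia.
  have kv1 : ancestor k v = ancestor k (ancestor k.+1 v).
    by rewrite ancestor_trans //; lia.
  apply: (@leq_add _ _ 1 1).
    apply: dist_horizontal => // _ i; rewrite (via u) ?(via v) //; last by lia.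
    have psi_small : psi <= 2 ^ (l - k).
      by apply: leq_trans (ltnW (ltn_expl (l - k) (ltnSn 1))); rewrite /l; lia.
    have [uv_i vu_i] := near i; apply/andP.
    by split; apply: quotient_step; [apply: leq_trans uv_i _ | apply: leq_trans vu_i _];
      rewrite leq_add2l.
  rewrite kv1 dist_sym; apply: leq_trans (dist_ancestor _) _; rewrite /=; lia.
- move=> R; exists R => k u Rk ku /(deep _ _ ku) u_deep.
  by apply: leq_trans (apex_level u); lia.
Qed.

(** The robber stays at level [K] and visits stations, the sequences with values 0
and [2 ^ K]; in one move he flips one of the coordinates. Nearness of a cop is
measured on ancestors at level [l]: no walk of length [tau] from level [K] rises
above it, and there the two values are [2 ^ l] and 0, still far apart. *)
Lemma cone_evasion k sigma rho :
  exists psi R, [/\ 0 < psi, 0 < R & evasion (G := cone) k sigma rho psi R apex].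
Proof.
pose tau := rho + sigma; pose l := tau.*2.+1; pose K := l + tau.
exists (2 ^ K), K.+1; split=> //; first by rewrite expn_gt0.
pose top (b : bool) : nat := if b then 2 ^ K else 0.
pose station (b : nat -> bool) : cone := (K, fun i => top (b i)).
pose coordinate (b : bool) s := if b then 2 ^ K - s else s.
pose walker (b : nat -> bool) j s : cone :=
  (K, fun i => if i == j then coordinate (b i) s else top (b i)).
pose flip (b : nat -> bool) j i := (i == j) (+) b i.
pose near t (u c : cone) :=
  K <= c.1 + t /\ values_within (ancestor l u).2 (ancestor l c).2 t.
have near_dist (f : nat -> nat) (c : cone) :
    dist ((K, f) : cone) c <= rho -> near rho (K, f) c.
  move=> uc; split.
    apply: leq_trans (level_dist c ((K, f) : cone)) _.
    by rewrite leq_add2l dist_sym.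
  by apply: ancestor_lipschitz; rewrite //= leq_add2l leq_addr.
have near_move (u c c' : cone) : near rho u c' -> dist c c' <= sigma -> near tau u c.
  move=> [c'K uc'] cc'; split; first by have := level_dist c c'; rewrite /tau; lia.
  rewrite dist_sym in cc'.
  have lc' : l + sigma <= c'.1 by rewrite /K /tau in c'K; lia.
  have c'c := ancestor_lipschitz (ltn0Sn _) cc' lc'.
  move=> i; have [] := uc' i; have [] := c'c i.
  move: ((ancestor l u).2 i) ((ancestor l c).2 i) ((ancestor l c').2 i).
  by rewrite /tau; lia.
have stationE b i : (ancestor l (station b)).2 i = if b i then 2 ^ l else 0.
  rewrite /= addKn /top; case: (b i); last by rewrite div0n.
  by rewrite expnD mulnK // expn_gt0.
have one_station b c j j' :
    near tau (station (flip b j)) c -> near tau (station (flip b j')) c -> j = j'.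
  move=> [_ /(_ j)] + [_ /(_ j)]; rewrite !stationE /flip eqxx.
  have := ltn_expl l (ltnSn 1); case: eqP => // _; case: (b j) => /=;
  by move: (2 ^ l) ((ancestor l c).2 j); rewrite /l; lia.
(* A route along coordinate j agrees with the station b in all the others, so two
   routes together show all the coordinates of the station. *)
have one_route b c j j' : j != j' -> (exists s, near rho (walker b j s) c) ->
    (exists s, near rho (walker b j' s) c) -> near rho (station b) c.
  move=> jj' [s [cK near_j]] [s' [_ near_j']]; split=> // i.
  have [ij|ij] := eqVneq i j.
    have := near_j' i; rewrite /= ij (negbTE jj'); exact.
  by have := near_j i; rewrite /= (negbTE ij).
have walker0 b j : walker b j 0 = station b.
  by congr pair; apply: funext => i; case: eqP => // _; case: (b i); rewrite //= subn0.
have walkerK b j : walker b j (2 ^ K) = station (flip b j).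
  congr pair; apply: funext => i; rewrite /flip; case: eqP => //= _.
  by case: (b i); rewrite //= subnn.
have walker_adj b j s : s < 2 ^ K -> adj (walker b j s) (walker b j s.+1).
  move=> sK; apply/asboolP; left; right; split=> //.
    move/(congr1 (fun w : cone_vertex => w.2 j)); rewrite /= eqxx.
    rewrite /coordinate; case: (b j); last by lia.
    by move: (2 ^ K) sK; lia.
  move=> _ i /=; case: eqP => _; last by rewrite /adjacent_values leqnSn.
  by rewrite /coordinate /adjacent_values; move: (2 ^ K) sK; case: (b i); lia.
exists (fun c u => exists2 b, u = station b & forall i, ~ near tau (station b) (c i)).
split.
- move=> c; have [z zP] := fresh_index (fun i => @one_station (fun=> false) (c i)).
  exists (station (flip (fun=> false) z)); eexists => // i /zP; by rewrite ltnn.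
- by move=> c _ [b -> _]; exact: dist_apex_le.
move=> c c' _ [b -> far] cc'.
have far' i : ~ near rho (station b) (c' i).
  by move=> /near_move/(_ (cc' i)); apply: far.
split=> [i|].
  by rewrite ltnNge; apply/negP => /near_dist; apply: far'.
have [|z zP] := fresh_index (P := fun i j => exists s, near rho (walker b j s) (c' i)).
  move=> i j j' nj nj'; apply/eqP; apply: contrapT => /negP jj'.
  exact: far' (one_route _ _ _ _ jj' nj nj').
have [z' z'P] := fresh_index (fun i => @one_station b (c' i)).
(* From z on, no route is blocked; from z' on, no destination is threatened. *)
exists (station (flip b (z + z'))); last first.
  by eexists => // i /z'P; rewrite ltnNge leq_addl.
rewrite -(walker0 b (z + z')) -walkerK.
apply: (robber_move_along (f := walker b (z + z'))) => // [s|s i _]; first exact: walker_adj.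
rewrite ltnNge; apply/negP => /near_dist near_s.
have : exists s, near rho (walker b (z + z') s) (c' i) by exists s.
by move/zP; rewrite ltnNge leq_addr.
Qed.

End Cone.

(** * The two cop numbers *)

Lemma least_positive_Some (P : nat -> Prop) n :
  0 < n -> P n -> (forall k, k < n -> ~ P k) -> least_positive P = Some n.
Proof.
move=> n_gt0 Pn least; rewrite /least_positive; case: pselect => [exP|]; last first.
  by case; exists n; apply/asboolP.
congr Some; case: ex_minnP => m /asboolP[_ Pm] min_m; apply/eqP.
rewrite eqn_leq min_m; last by apply/asboolP.
by rewrite leqNgt; apply/negP => /least.
Qed.

Lemma least_positive_None (P : nat -> Prop) :
  (forall k, ~ P k) -> least_positive P = None.
Proof.
move=> noP; rewrite /least_positive; case: pselect => // exP.
by have [k /asboolP[_ /noP]] := exP.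
Qed.

Lemma weak_strong (G : connected_graph) k : weak_cop_win G k -> strong_cop_win G k.
Proof.
case=> sigma sigma_gt0 [rho win]; exists sigma => // psi psi_gt0.
by exists rho => R; apply: win.
Qed.

Definition point_graph :=
  @Graph unit (fun _ _ => false) (fun _ _ => erefl) (fun _ => erefl).

Lemma point_connected : connected point_graph.
Proof. by split=> // -[] []; exists [::]. Qed.

Definition point := ConnectedGraph point_connected.

Lemma point_one_cop_herds sigma rho psi :
  one_cop_herds (tt : point) sigma rho psi (fun _ _ => True) (fun _ => id).
Proof.
have near (x y : point) d : d < dist x y -> False.
  by case: x y => -[]; rewrite dist_refl.
split=> [x|_ x _ /near|_ x y _ /near|R] //; last by exists 0 => k x _ _ /near.
by case: x; split=> //; rewrite dist_refl.
Qed.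

Theorem corollary15 : forall n : nat, 0 < n ->
  (exists Delta : connected_graph, wCop Delta = Some n /\ sCop Delta = Some n) /\
  (exists Gamma : connected_graph, wCop Gamma = None /\ sCop Gamma = Some n).
Proof.
case=> [//|n] _; split.
  have weak : weak_cop_win (bouquet (tt : point) n) n.+1.
    exists 1 => //; exists 0 => psi R _ _.
    exact: bouquet_CopWin (point_one_cop_herds 1 0 psi).
  have strong k : k < n.+1 -> ~ strong_cop_win (bouquet (tt : point) n) k.
    exact: bouquet_not_strong.
  exists (bouquet (tt : point) n); split; apply: least_positive_Some => //.
    by move=> k kn /weak_strong; apply: strong.
  exact: weak_strong.
exists (bouquet (apex : cone) n); split.
  apply: least_positive_None => k [sigma _ [rho win]].
  have [psi [R [psi_gt0 R_gt0 ev]]] := cone_evasion k sigma rho.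
  have {}ev := evasion_retract (inj := Ext : cone -> bouquet (apex : cone) n)
    (fun=> erefl) (@Ext_adj _ _ _) (@retract_adj _ _ _) ev.
  exact: evasion_not_CopWin ev (win _ _ psi_gt0 R_gt0).
apply: least_positive_Some => // [|k kn]; last exact: bouquet_not_strong.
exists 2 => // psi _; exists psi.*2 => R _.
exact: bouquet_CopWin (cone_one_cop_herds psi).
Qed.
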